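(* For the directed cycles $\overrightarrow{C_n}$, $n\ge2$, $$\sum_{n\ge2}X_{\overrightarrow{C_n}}(\mathbf{x},t)\,z^n=\frac{t\displaystyle\sum_{k\ge2}k\,[k-1]_t\,e_k\,z^k}{1-t\displaystyle\sum_{k\ge2}[k-1]_t\,e_k\,z^k},$$ where $[k]_t=1+t+\cdots+t^{k-1}$. Consequently, $X_{\overrightarrow{C_n}}(\mathbf{x},t)$ is palindromic, $e$-positive, and $e$-unimodal.
   Context: $\overrightarrow{C_n}$ is the cycle on $n$ vertices oriented cyclically, with directed edges $1\to2\to\cdots\to n\to1$ (for $n=2$: the two directed edges $1\to2$ and $2\to1$). For a digraph $\overrightarrow{G}=(V,E)$, a proper coloring is a map $\kappa:V\to\mathbb{P}=\{1,2,3,\dots\}$ with $\kappa(u)\ne\kappa(v)$ whenever $u,v$ are adjacent, $\mathrm{asc}(\kappa)=|\{(u,v)\in E:\kappa(u)<\kappa(v)\}|$ (where $(u,v)$ is directed from $u$ to $v$), and $$X_{\overrightarrow{G}}(\mathbf{x},t)=\sum_{\kappa}t^{\mathrm{asc}(\kappa)}\prod_{v\in V}x_{\kappa(v)},$$ summed over all proper colorings. $e_k$ is the $k$th elementary symmetric function in $x_1,x_2,\dots$, and $e_\lambda=e_{\lambda_1}e_{\lambda_2}\cdots$. The identity is one of formal power series in $z$. Let $m$ be the number of directed edges (here $m=n$) and write $X_{\overrightarrow{G}}(\mathbf{x},t)=\sum_{j=0}^m a_j(\mathbf{x})t^j$. Palindromic means $a_j=a_{m-j}$ for all $j$. A symmetric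 function is $e$-positive if its expansion in the basis $\{e_\lambda\}$ has nonnegative coefficients; $X_{\overrightarrow{G}}(\mathbf{x},t)$ is $e$-positive if every $a_j$ is, and it is $e$-unimodal if $a_{j+1}(\mathbf{x})-a_j(\mathbf{x})$ is $e$-positive for all $0\le j<\frac{m-1}{2}$. *)

(* Defs.v *)
From HB Require Import structures.
From mathcomp Require Import all_boot all_order all_algebra finmap.
From mathcomp Require Import boolp classical_sets functions cardinality fsbigop.
From mathcomp Require Import monalg.

Set Implicit Arguments.
Unset Strict Implicit.
Unset Printing Implicit Defensive.

Import Order.TTheory GRing.Theory Num.Theory.

Local Open Scope classical_set_scope.
Local Open Scope ring_scope.

Local Notation "1" := (@mone _) : monom_scope.
Local Notation "x * y" := (mmul x y) : monom_scope.

(** Formal power series in commuting variables [x_i], [i : I]: the value of a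
    series at a monomial is the coefficient of that monomial. *)

Record fps (I : choiceType) (R : Type) := Fps { fcoef : {cmonom I} -> R }.
Arguments Fps {I R} fcoef.
Coercion fcoef : fps >-> Funclass.

HB.instance Definition _ (I : choiceType) (R : Type) :=
  [isNew for @fcoef I R].
HB.instance Definition _ (I R : choiceType) := [Choice of fps I R by <:].

Lemma fpsP (I : choiceType) (R : Type) (f g : fps I R) : f =1 g -> f = g.
Proof. by case: f g => [f] [g] /= /funext ->. Qed.

Section FpsRing.
Variables (I : choiceType) (R : comNzRingType).
Implicit Types (f g h : fps I R) (m a b : {cmonom I}).

Definition fps_zero : fps I R := Fps (fun=> 0).
Definition fps_opp f : fps I R := Fps (fun m => - f m).
Definition fps_add f g : fps I R := Fps (fun m => f m + g m).
Definition fps_one : fps I R := Fps (fun m => (m == 1%M)%:R).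
Definition fps_mul f g : fps I R :=
  Fps (fun m => \sum_(p \in [set p | (p.1 * p.2)%M = m]) f p.1 * g p.2).
Definition fps_scale (c : R) f : fps I R := Fps (fun m => c * f m).

Fact fps_addA : associative fps_add.
Proof. by move=> f g h; apply: fpsP => m /=; rewrite addrA. Qed.
Fact fps_addC : commutative fps_add.
Proof. by move=> f g; apply: fpsP => m /=; rewrite addrC. Qed.
Fact fps_add0 : left_id fps_zero fps_add.
Proof. by move=> f; apply: fpsP => m /=; rewrite add0r. Qed.
Fact fps_addN : left_inverse fps_zero fps_opp fps_add.
Proof. by move=> f; apply: fpsP => m /=; rewrite addNr. Qed.

HB.instance Definition _ :=
  GRing.isZmodule.Build (fps I R) fps_addA fps_addC fps_add0 fps_addN.

Lemma fcoef0 m : (0 : fps I R) m = 0. Proof. by []. Qed.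
Lemma fcoefD f g m : (f + g) m = f m + g m. Proof. by []. Qed.
Lemma fcoefN f m : (- f) m = - f m. Proof. by []. Qed.
Lemma fcoefB f g m : (f - g) m = f m - g m. Proof. by []. Qed.
Lemma fcoef_sum (K : Type) (r : seq K) (P : pred K) (F : K -> fps I R) m :
  (\sum_(k <- r | P k) F k) m = \sum_(k <- r | P k) F k m.
Proof. by elim/big_rec2: _ => // k y x _ <-. Qed.

Definition cmdvd a m : bool :=
  `[< exists b, (a * b)%M = m >].

Lemma finite_cmdvd m : finite_set [set a | cmdvd a m].
Proof.
pose X := finsupp m; pose N := (mdeg m).+1.
pose F (u : {ffun X -> 'I_N}) : {cmonom I} :=
  CMonom [fsfun i : X => (u i : nat) | 0%N].
apply: (@sub_finite_set _ _ [set F u | u in [set: {ffun X -> 'I_N}]]).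
  move=> a /asboolP [b ab].
  have le i : (a i <= m i)%N by rewrite -ab cmM leq_addr.
  have lt i : (a i < N)%N.
    apply: (leq_ltn_trans (le i)); rewrite ltnS mdegE.
    have [iX|iX] := boolP (i \in X); last by rewrite fsfun_dflt.
    by rewrite (big_fsetD1 i) //= leq_addr.
  exists [ffun i : X => Ordinal (lt (val i))] => //.
  apply/eqP/cmP => i; rewrite /F fsfun_ffun.
  case: insubP => [u _ uE|iX] /=; first by rewrite ffunE /= uE.
  by apply/esym/eqP; rewrite -leqn0 (leq_trans (le i)) // fsfun_dflt.
by apply: finite_image; exact: finite_finset.
Qed.

Fact cmdivs_key : unit. Proof. by []. Qed.
Definition cmdivs m : {fset {cmonom I}} :=
  locked_with cmdivs_key (fset_set [set a | cmdvd a m]).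

Lemma cmdivsP a m : reflect (exists b, (a * b)%M = m) (a \in cmdivs m).
Proof.
rewrite /cmdivs unlock in_fset_set; last exact: finite_cmdvd.
by apply: (iffP idP) => [/set_mem/asboolP|ab] //; apply/mem_set/asboolP.
Qed.

Lemma cmdivsl a b : a \in cmdivs (a * b)%M.
Proof. by apply/cmdivsP; exists b. Qed.
Lemma cmdivsr a b : b \in cmdivs (a * b)%M.
Proof. by apply/cmdivsP; exists a; rewrite mulmC. Qed.
Lemma cmdivs_trans a b m : a \in cmdivs b -> b \in cmdivs m -> a \in cmdivs m.
Proof.
move=> /cmdivsP[c <-] /cmdivsP[d <-]; apply/cmdivsP.
by exists (c * d)%M; rewrite mulmA.
Qed.

Lemma finite_cmfact m :
  finite_set [set p : {cmonom I} * {cmonom I} | (p.1 * p.2)%M = m].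
Proof.
apply: sub_finite_set (finite_setX (finite_cmdvd m) (finite_cmdvd m)).
move=> [a b] /= <-; split; apply/asboolP; first by exists b.
by exists a; rewrite mulmC.
Qed.

Lemma fps_mulEw (D : {fset {cmonom I}}) f g m : {subset cmdivs m <= D} ->
  fps_mul f g m =
  \sum_(a <- D) \sum_(b <- D) (f a * g b) *+ ((a * b)%M == m).
Proof.
move=> sD; pose H (p : {cmonom I} * {cmonom I}) :=
  (f p.1 * g p.2) *+ ((p.1 * p.2)%M == m).
transitivity (\sum_(p \in [set p | (p.1 * p.2)%M = m]) H p).
  by apply: eq_fsbigr => p /set_mem /= pm; rewrite /H pm eqxx.
rewrite (fsbig_fwiden [seq (a, b) | a <- D, b <- D]); last first.
- by move=> p [_ /= /eqP/negPf pm]; rewrite /H /= pm.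
- by apply: allpairs_uniq; rewrite ?fset_uniq // => -[a b] [c d].
- move=> [a b] /= abm; apply/allpairsP; exists (a, b).
  split=> //=; apply: sD; rewrite -abm; first exact: cmdivsl.
  exact: cmdivsr.
- by rewrite big_allpairs.
Qed.

Lemma fps_mulE f g m :
  fps_mul f g m = \sum_(a <- cmdivs m) \sum_(b <- cmdivs m)
                    (f a * g b) *+ ((a * b)%M == m).
Proof. exact: fps_mulEw. Qed.

Fact fps_mulC : commutative fps_mul.
Proof.
move=> f g; apply: fpsP => m; rewrite !fps_mulE exchange_big /=.
by apply: eq_bigr => a _; apply: eq_bigr => b _; rewrite mulrC mulmC.
Qed.

Fact fps_mulA : associative fps_mul.
Proof.
move=> f g h; apply: fpsP => m.
set D := cmdivs m; have sD a : a \in D -> {subset cmdivs a <= D}.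
  by move=> aD b ba; apply: cmdivs_trans aD.
have collapse (x : {cmonom I}) (F : {cmonom I} -> R) (P : pred {cmonom I}) :
    (P x -> x \in D) ->
  \sum_(y <- D) (F y *+ (x == y)) *+ P y = F x *+ P x.
  move=> xD; case Px: (P x); last first.
    rewrite big1 // => y _; have [<-|] := eqVneq x y; first by rewrite Px.
    by rewrite mulr0n mul0rn.
  rewrite (big_fsetD1 x) ?xD //= eqxx Px big1_fset ?addr0 // => y.
  by rewrite !inE => /andP[/negPf yx _] _; rewrite eq_sym yx mul0rn.
transitivity (\sum_(a <- D) \sum_(b <- D) \sum_(c <- D)
                (f a * g b * h c) *+ ((a * b * c)%M == m)).
  rewrite fps_mulE; apply: eq_big_seq => a aD.
  under eq_big_seq => q qD.
    rewrite (fps_mulEw _ _ (sD _ qD)) mulr_sumr -sumrMnl.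
    under eq_bigr do rewrite mulr_sumr -sumrMnl.
    over.
  rewrite exchange_big /=; apply: eq_bigr => b _.
  rewrite exchange_big /=; apply: eq_bigr => c _.
  rewrite -mulmA -mulrA.
  rewrite -(collapse (b * c)%M (fun=> _) (fun q => (a * q)%M == m)); last first.
    by move=> /eqP abm; rewrite /D -abm; exact: cmdivsr.
  by apply: eq_bigr => q _; rewrite mulrnAr.
symmetry; rewrite fps_mulE.
under eq_big_seq => q qD.
  under eq_bigr => c _.
    rewrite (fps_mulEw _ _ (sD _ qD)) mulr_suml -sumrMnl.
    under eq_bigr do rewrite mulr_suml -sumrMnl.
    over.
  rewrite exchange_big /=.
  under eq_bigr do rewrite exchange_big /=.
  over.
rewrite exchange_big /=; apply: eq_bigr => a _.
rewrite exchange_big /=; apply: eq_bigr => b _.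
rewrite exchange_big /=; apply: eq_bigr => c _.
rewrite -(collapse (a * b)%M (fun=> _) (fun q => (q * c)%M == m)); last first.
  by move=> /eqP abm; rewrite /D -abm; exact: cmdivsl.
by apply: eq_bigr => q _; rewrite mulrnAl.
Qed.

Fact fps_mul1 : left_id fps_one fps_mul.
Proof.
move=> f; apply: fpsP => m; rewrite fps_mulE.
have D1 : (1%M : {cmonom I}) \in cmdivs m.
  by apply/cmdivsP; exists m; rewrite mul1m.
have Dm : m \in cmdivs m by apply/cmdivsP; exists 1%M; rewrite mulm1.
rewrite (big_fsetD1 _ D1) /= [X in _ + X]big1_fset ?addr0; last first.
  move=> a; rewrite !inE => /andP[/negPf a1 _] _.
  by rewrite big1 // => b _; rewrite a1 mul0r mul0rn.
rewrite (big_fsetD1 _ Dm) /= big1_fset ?addr0.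
  by rewrite eqxx mul1r mul1m eqxx.
by move=> b; rewrite !inE => /andP[/negPf bm _] _; rewrite mul1m bm.
Qed.

Fact fps_mulDl : left_distributive fps_mul fps_add.
Proof.
move=> f g h; apply: fpsP => m.
transitivity (fps_mul f h m + fps_mul g h m); last by [].
rewrite !fps_mulE -big_split.
apply: eq_bigr => a _; rewrite -big_split; apply: eq_bigr => b _ /=.
by rewrite mulrDl mulrnDl.
Qed.

Fact fps_oner_neq0 : fps_one != 0.
Proof.
apply/eqP => /(congr1 (fun f : fps I R => f 1%M)) /= /eqP.
by rewrite eqxx oner_eq0.
Qed.

HB.instance Definition _ := GRing.Zmodule_isComNzRing.Build (fps I R)
  fps_mulA fps_mulC fps_mul1 fps_mulDl fps_oner_neq0.

Lemma fcoef1 m : (1 : fps I R) m = (m == 1%M)%:R. Proof. by []. Qed.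

Lemma fcoefM f g m :
  (f * g) m = \sum_(p \in [set p | (p.1 * p.2)%M = m]) f p.1 * g p.2.
Proof. by []. Qed.

Lemma fcoefME f g m :
  (f * g) m = \sum_(a <- cmdivs m) \sum_(b <- cmdivs m)
                (f a * g b) *+ ((a * b)%M == m).
Proof. exact: fps_mulE. Qed.

Fact fps_scaleA (c d : R) f :
  fps_scale c (fps_scale d f) = fps_scale (c * d) f.
Proof. by apply: fpsP => m /=; rewrite mulrA. Qed.
Fact fps_scale1 : left_id 1 fps_scale.
Proof. by move=> f; apply: fpsP => m /=; rewrite mul1r. Qed.
Fact fps_scaleDr : right_distributive fps_scale +%R.
Proof. by move=> c f g; apply: fpsP => m /=; rewrite mulrDr. Qed.
Fact fps_scaleDl f : {morph fps_scale^~ f : c d / c + d}.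
Proof. by move=> c d; apply: fpsP => m /=; rewrite mulrDl. Qed.

HB.instance Definition _ := GRing.Zmodule_isLmodule.Build R (fps I R)
  fps_scaleA fps_scale1 fps_scaleDr fps_scaleDl.

Lemma fcoefZ (c : R) f m : (c *: f) m = c * f m. Proof. by []. Qed.

Fact fps_scaleAl (c : R) f g : c *: (f * g) = c *: f * g.
Proof.
apply: fpsP => m; rewrite fcoefZ !fcoefME mulr_sumr; apply: eq_bigr => a _.
by rewrite mulr_sumr; apply: eq_bigr => b _; rewrite mulrnAr mulrA.
Qed.

HB.instance Definition _ :=
  GRing.Lmodule_isLalgebra.Build R (fps I R) fps_scaleAl.
HB.instance Definition _ :=
  GRing.Lalgebra_isComAlgebra.Build R (fps I R).

(** The inverse is chosen classically; by [fps_unit1] below every series with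
    constant term [1] is a unit. *)
Definition fps_unit : pred (fps I R) := fun f => `[< exists g, g * f = 1 >].
Definition fps_inv f : fps I R :=
  if pselect (exists g, g * f = 1) is left ex then projT1 (cid ex) else f.

Fact fps_mulVr : {in fps_unit, left_inverse 1 fps_inv *%R}.
Proof.
move=> f /asboolP fu; rewrite /fps_inv; case: pselect => // ex.
by case: (cid ex).
Qed.
Fact fps_unitPl f g : g * f = 1 -> fps_unit f.
Proof. by move=> gf; apply/asboolP; exists g. Qed.
Fact fps_inv_out : {in [predC fps_unit], fps_inv =1 id}.
Proof.
move=> f; rewrite inE /fps_inv => /negP fu; case: pselect => // ex.
by case: fu; apply/asboolP.
Qed.

HB.instance Definition _ := GRing.ComNzRing_hasMulInverse.Build (fps I R)
  fps_mulVr fps_unitPl fps_inv_out.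

Lemma fcoefX_lt (h : fps I R) : h 1%M = 0 ->
  forall n m, (mdeg m < n)%N -> (h ^+ n) m = 0.
Proof.
move=> h0; elim=> [//|n IHn] m mn; rewrite exprS fcoefME.
rewrite big1 // => a _; rewrite big1 // => b _; case: eqP => // abm.
rewrite mulr1n; have [->|a1] := eqVneq a 1%M; first by rewrite h0 mul0r.
rewrite (IHn b) ?mulr0 //; move: mn; rewrite -abm mdegM ltnS => mn.
by apply: leq_trans mn; rewrite -[X in (X < _)%N]add0n ltn_add2r lt0n mdeg_eq0.
Qed.

Lemma fps_unit1 f : f 1%M = 1 -> f \is a GRing.unit.
Proof.
move=> f1; pose h := 1 - f.
have h0 : h 1%M = 0 by rewrite fcoefB fcoef1 eqxx f1 subrr.
pose g : fps I R := Fps (fun m => (\sum_(n < (mdeg m).+1) h ^+ n) m).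
apply/unitrPr; exists g; apply: fpsP => m.
pose gm := \sum_(n < (mdeg m).+1) h ^+ n.
have -> : (f * g) m = (f * gm) m.
  rewrite !fcoefME; apply: eq_bigr => a _; apply: eq_bigr => b _.
  case: eqP => // abm; congr (f a * _ *+ _).
  rewrite /gm /= !fcoef_sum -(big_mkord xpredT (fun n => (h ^+ n) b)).
  rewrite -(big_mkord xpredT (fun n => (h ^+ n) b)).
  have le : (mdeg b <= mdeg m)%N by rewrite -abm mdegM leq_addl.
  rewrite [RHS](@big_cat_nat _ _ _ (mdeg b).+1) //= [X in _ + X]big_nat_cond.
  rewrite [X in _ + X]big1 ?addr0 // => n.
  by rewrite andbT => /andP[lbn _]; exact: fcoefX_lt.
have fE : f = 1 - h by rewrite /h opprB addrC subrK.
by rewrite fE /gm -opprB mulNr -subrX1 opprB fcoefB fcoefX_lt // subr0.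
Qed.
End FpsRing.

(** Coefficientwise sum of a possibly infinite family of series.  As finitely
    supported sums default to [0], it is meaningful only for families that are
    [summable] below; all the families used here are (see
    [elemsym_summable], [chromqsym_summable], [zseries_summable]). *)
Definition fps_sum (I : choiceType) (R : comNzRingType) (K : choiceType)
    (A : set K) (F : K -> fps I R) : fps I R :=
  Fps (fun m => \sum_(k \in A) F k m).

Notation "\fps_sum_ ( k '\in' A ) F" := (fps_sum A (fun k => F))
  (at level 41, F at level 41, k name, A at level 60,
   format "'[' \fps_sum_ ( k  '\in'  A ) '/  '  F ']'") : ring_scope.

Definition fps_var (I : choiceType) (R : comNzRingType) (i : I) : fps I R :=
  Fps (fun m => (m == ucm i)%:R).
Arguments fps_var {I R} i.

Section Summable.
Variables (I : choiceType) (R : comNzRingType).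

Definition summable (K : choiceType) (A : set K) (F : K -> fps I R) : Prop :=
  forall m, finite_set [set k | A k /\ F k m != 0].

Lemma fps_monomM (a b : {cmonom I}) :
  Fps (fun m => (m == a)%:R) * Fps (fun m => (m == b)%:R) =
  Fps (fun m => (m == (a * b)%M)%:R) :> fps I R.
Proof.
apply: fpsP => m; rewrite fcoefME /=.
have [->|mab] := eqVneq m (a * b)%M; last first.
  rewrite big1 // => x _; rewrite big1 // => y _.
  have [->|] := eqVneq x a; last by rewrite mul0r mul0rn.
  have [->|] := eqVneq y b; last by rewrite mulr0 mul0rn.
  by rewrite eq_sym (negPf mab).
rewrite (big_fsetD1 _ (cmdivsl a b)) /= (big_fsetD1 _ (cmdivsr a b)) /=.
rewrite !eqxx mulr1 mulr1n [X in _ + X + _]big1_fset; last first.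
  by move=> y; rewrite !inE => /andP[/negPf -> _] _; rewrite mulr0 mul0rn.
rewrite [X in _ + X]big1_fset ?addr0 //.
move=> x; rewrite !inE => /andP[/negPf -> _] _.
by rewrite big1 // => y _; rewrite mul0r mul0rn.
Qed.

Lemma fps_prod_var (K : Type) (r : seq K) (P : pred K) (i : K -> I) :
  \prod_(k <- r | P k) fps_var (i k) =
  Fps (fun m => (m == \big[mmul/1%M]_(k <- r | P k) ucm (i k))%:R) :> fps I R.
Proof.
elim/big_rec2: _ => [|k m f _ ->]; first exact: fpsP.
by rewrite /fps_var fps_monomM.
Qed.

Lemma fps_var_exp (i : I) n m :
  (fps_var i ^+ n : fps I R) m != 0 -> mdeg m = n.
Proof.
rewrite -[n in _ ^+ n]card_ord -prodr_const fps_prod_var /=.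
case: (m =P _) => [-> _|]; last by rewrite eqxx.
rewrite mdeg_prod (eq_bigr (fun=> 1%N)) => [|j _]; last exact: mdegU.
by rewrite sum1_card card_ord.
Qed.
End Summable.

Definition color := {i : nat | (0 < i)%N}.

Section Symmetric.
Variable R : comNzRingType.

Definition elemsym (k : nat) : fps color R :=
  \fps_sum_(S \in [set S : {fset color} | #|` S| = k])
    \prod_(i <- S) fps_var i.

Lemma elemsym_summable k :
  summable [set S : {fset color} | #|` S| = k]
    (fun S => \prod_(i <- S) fps_var i : fps color R).
Proof.
move=> m; apply: (@sub_finite_set _ _ [set` fpowerset (finsupp m)]); last first.
  exact: finite_fset.
move=> S [_]; rewrite fps_prod_var /=.
case: (m =P _) => [-> _|]; last by rewrite eqxx.
rewrite fpowersetE; apply/fsubsetP => i iS.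
rewrite -cmE_neq0 (big_fsetD1 i) //= cmM cmU eqxx.
by [].
Qed.

Definition is_partition (la : seq nat) : bool :=
  sorted geq la && all (leq 1) la.

Definition elemsym_part (la : seq nat) : fps color R :=
  \prod_(k <- la) elemsym k.
End Symmetric.
Arguments elemsym {R} k.
Arguments elemsym_part {R} la.

(** The [e_la] form a basis of the symmetric functions, so a nonnegative
    expansion exists iff the coefficients of the unique expansion are
    nonnegative. *)
Definition e_positive (f : fps color int) : Prop :=
  exists (s : seq (seq nat)) (c : seq nat -> int),
    [/\ uniq s, forall la, la \in s -> is_partition la,
        forall la, la \in s -> 0 <= c la
      & f = \sum_(la <- s) c la *: elemsym_part la].

Section Digraph.
Variables (V : finType) (E : rel V).

Definition nedges : nat := #|[pred uv : V * V | E uv.1 uv.2]|.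

Definition proper_coloring (kappa : {ffun V -> color}) : Prop :=
  forall u v, E u v || E v u -> kappa u != kappa v.

Definition asc (kappa : {ffun V -> color}) : nat :=
  #|[pred uv : V * V | E uv.1 uv.2 &
       (val (kappa uv.1) < val (kappa uv.2))%N]|.

(** The coefficient ring is [int[t]], with [t] the polynomial variable ['X]. *)
Definition chromqsym : fps color {poly int} :=
  \fps_sum_(kappa \in [set kappa | proper_coloring kappa])
    'X^(asc kappa) *: \prod_v fps_var (kappa v).

Lemma chromqsym_summable :
  summable [set kappa | proper_coloring kappa]
    (fun kappa => 'X^(asc kappa) *: \prod_v fps_var (kappa v)
       : fps color {poly int}).
Proof.
move=> m; pose X := finsupp m.
pose F (u : {ffun V -> X}) := [ffun v => val (u v)].
apply: (@sub_finite_set _ _ [set F u | u in [set: {ffun V -> X}]]).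
  move=> kappa [_]; rewrite fcoefZ fps_prod_var /=.
  case: (m =P _) => [mE _|_]; last by rewrite mulr0 eqxx.
  have kX v : kappa v \in X.
    by rewrite -cmE_neq0 mE (bigD1 v) //= cmM cmU eqxx.
  exists [ffun v => FSetSub (kX v)] => //.
  by apply/ffunP => v; rewrite !ffunE.
by apply: finite_image; exact: finite_finset.
Qed.
End Digraph.

Definition t_coef (F : fps color {poly int}) (j : nat) : fps color int :=
  Fps (fun m => (F m)`_j).

Section Properties.
Variables (m : nat) (F : fps color {poly int}).

Definition t_palindromic : Prop :=
  forall j, (j <= m)%N -> t_coef F j = t_coef F (m - j).

Definition t_e_positive : Prop :=
  forall j, (j <= m)%N -> e_positive (t_coef F j).

(** [j.*2.+1 < m] is [j < (m - 1) / 2]. *)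
Definition t_e_unimodal : Prop :=
  forall j, (j.*2.+1 < m)%N -> e_positive (t_coef F j.+1 - t_coef F j).
End Properties.

(** [ordS i] is [i + 1] modulo [n]. *)
Definition dcycle (n : nat) : rel 'I_n := fun i j => j == ordS i.
Arguments dcycle n : clear implicits.

Lemma nedges_dcycle n : nedges (dcycle n) = n.
Proof.
have inj : injective (fun i : 'I_n => (i, ordS i)) by move=> i j [].
rewrite /nedges -[RHS]card_ord -(card_codom inj); apply: eq_card => -[i j].
rewrite inE /= /dcycle; apply/eqP/codomP => [->|[k [-> ->]]] //.
by exists i.
Qed.

Definition tnum (k : nat) : {poly int} := \sum_(i < k) 'X^i.

(** Power series in the single variable [z = zvar] over the ring of series in
    the [x_i]; [tvar] is the constant series [t]. *)
Notation zseries := (fps unit (fps color {poly int})).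
Definition zvar : zseries := fps_var tt.
Definition tvar : zseries := ('X : {poly int})%:A%:A.

Lemma zseries_summable (A : set nat) (F : nat -> fps color {poly int}) :
  summable A (fun n => F n *: zvar ^+ n).
Proof.
move=> m; apply: (@sub_finite_set _ _ [set mdeg m]); last exact: finite_set1.
move=> n [_]; rewrite fcoefZ /= => Fn.
apply/esym; apply: (@fps_var_exp _ (fps color {poly int}) tt).
by apply: contraNneq Fn => ->; rewrite mulr0.
Qed.

(* Main.v *)
(** With the colors cut down to [1..N], proper colorings of the n-cycle are the
    closed walks of length n counted by the trace of the n-th power of the
    matrix M with entries [x_j t], [0], [x_j] according as i < j, i = j, i > j.
    Newton's identities express these traces through det (1 - zM).  Adding
    [c z x_j] to every entry of column j changes this determinant by an affine
    function of c, and makes the matrix triangular for c = 1 and for c = t;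
    hence (1 - t) det (1 - zM) = prod_j (1 + t z x_j) - t prod_j (1 + z x_j).
    Comparing coefficients, and letting N grow,
      X_n = n t [n-1] e_n + sum_(k < n) t [k-1] e_k X_(n-k),
    which is the generating function identity.  As multiplying a symmetric
    unimodal polynomial in t by t [k-1] keeps it symmetric and unimodal and
    moves its centre by k/2, X_n is by induction a sum of products p(t) e_la
    with p nonnegative, symmetric and unimodal, of centre n/2. *)

Require Import Defs.
From mathcomp Require Import all_boot all_order all_algebra finmap.
From mathcomp Require Import boolp classical_sets functions cardinality fsbigop.
From mathcomp Require Import monalg.
From mathcomp Require Import perm ring zify.

Set Implicit Arguments.
Unset Strict Implicit.
Unset Printing Implicit Defensive.

Import Order.TTheory GRing.Theory Num.Theory.

Local Open Scope classical_set_scope.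
Local Open Scope ring_scope.

(** * Newton's identities for the coefficients of det (1 - X M) *)

Section NewtonIdentity.
Variable R : comNzRingType.

Lemma deriv_prod_seq (I : eqType) (r : seq I) (F : I -> {poly R}) : uniq r ->
  (\prod_(i <- r) F i)^`() =
  \sum_(i <- r) (F i)^`() * \prod_(j <- r | j != i) F j.
Proof.
elim: r => [|x r IHr] /=; first by rewrite !big_nil -polyC1 derivC.
case/andP=> xr ur; rewrite !big_cons derivM IHr // eqxx /=; congr (_ * _ + _).
  rewrite big_seq [RHS]big_seq_cond; apply: eq_bigl => j.
  by have [->|] := eqVneq j x; rewrite ?(negPf xr) ?andbT.
rewrite mulr_sumr !big_seq; apply: eq_bigr => i ir; rewrite big_cons.
by case: eqVneq ir xr => [<- -> //|_ _ _]; rewrite mulrCA.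
Qed.

(** Jacobi's formula. In the Leibniz expansion the product rule differentiates one row at a time;
    [C i] is [B] with row i differentiated, and its determinant is expanded along that row. *)
Lemma deriv_det n (B : 'M[{poly R}]_n) :
  (\det B)^`() = \sum_i \sum_j (B i j)^`() * cofactor B i j.
Proof.
pose C i : 'M_n := \matrix_(k, j) if k == i then (B i j)^`() else B k j.
transitivity (\sum_i \det (C i)); last first.
  apply: eq_bigr => i _; rewrite (expand_det_row _ i); apply: eq_bigr => j _.
  rewrite mxE eqxx; congr (_ * (_ * \det _)); apply/matrixP => k l.
  by rewrite !mxE eq_sym (negPf (neq_lift _ _)).
rewrite /determinant raddf_sum exchange_big; apply: eq_bigr => /= s _.
rewrite -mulr_sumr !mulr_sign (fun_if (@deriv R)) derivN.
have -> : (\prod_i B i (s i))^`() = \sum_i \prod_j C i j (s j); last by [].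
rewrite (deriv_prod_seq _ (index_enum_uniq _)); apply: eq_bigr => i _.
rewrite [RHS](bigD1 i) //= mxE eqxx; congr (_ * _).
by apply: eq_bigr => j /negPf ji; rewrite mxE ji.
Qed.

Definition det1subX n (M : 'M[R]_n) : {poly R} :=
  \det (1%:M - 'X *: map_mx polyC M).

(* The derivative of det (1 - X M) is - tr (M adj (1 - X M)), and the
   coefficients of the adjugate follow from adj B * B = det B. *)
Lemma newton_det1subX n (M : 'M[R]_n.+1) k :
  (det1subX M)`_k.+1 *+ k.+1 =
  - \sum_(i < k.+1) (det1subX M)`_i * \tr (M ^+ (k - i).+1).
Proof.
set p := det1subX M; pose MP := map_mx polyC M.
pose B := 1%:M - 'X *: MP; pose D := \adj B.
have DE : D = p%:M + 'X *: (D *m MP).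
  have := mul_adj_mx B; rewrite -/p mulmxBr mulmx1 -scalemxAr => <-.
  by rewrite subrK.
have DC j : map_mx (fun q : {poly R} => q`_j) D =
            \sum_(i < j.+1) p`_i *: M ^+ (j - i).
  elim: j => [|j IHj].
    apply/matrixP => a b; rewrite big_ord1 expr0 {1}DE !mxE.
    by rewrite coefD coefXM addr0 coefMn; case: eqP; rewrite ?mulr1 ?mulr0.
  rewrite big_ord_recr /= subnn expr0.
  under eq_bigr => i _ do rewrite (@subSn i j (ltn_ord i)) exprSr scalerAl.
  rewrite -mulr_suml -IHj; apply/matrixP => a b.
  rewrite [LHS]mxE {1}DE [RHS]mxE [X in polyseq X]mxE coefD addrC.
  congr (_ + _).
    by rewrite !mxE coefMn; case: eqP; rewrite ?mulr1 ?mulr0.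
  rewrite [X in polyseq X]mxE coefXM /= !mxE coef_sum; apply: eq_bigr => c _.
  by rewrite !mxE coefMC.
rewrite -coef_deriv /p /det1subX deriv_det -/B.
have -> : \sum_i \sum_j (B i j)^`() * cofactor B i j = - \tr (MP *m D).
  rewrite /mxtrace -sumrN; apply: eq_bigr => i _.
  rewrite mxE -sumrN; apply: eq_bigr => j _.
  rewrite !mxE derivB derivMn -polyC1 derivC mul0rn sub0r derivM derivX derivC.
  by rewrite mulr0 addr0 mul1r mulNr.
rewrite coefN; congr (- _).
have -> : (\tr (MP *m D))`_k = \tr (M *m map_mx (fun q : {poly R} => q`_k) D).
  rewrite /mxtrace coef_sum; apply: eq_bigr => i _.
  by rewrite !mxE coef_sum; apply: eq_bigr => j _; rewrite !mxE coefCM.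
rewrite DC mulmx_sumr raddf_sum; apply: eq_bigr => i _ /=.
by rewrite -scalemxAr mxtraceZ exprS.
Qed.

End NewtonIdentity.

(** * The characteristic determinant and the traces of the ascent matrix *)

Section AscentMatrix.
Variables (R : comNzRingType) (n : nat).

(** By a Schur complement the determinant equals that of [B] bordered by the row (1, v) and the
    column (1, -c u). Only this column depends on c, and it does so affinely. *)
Lemma det_rank1_affine (B : 'M[R]_n) (u : 'cV_n) (v : 'rV_n) :
  exists g, forall c, \det (B + c *: (u *m v)) = \det B + c * g.
Proof.
exists (\det (block_mx 0 v (- u) B)) => c.
transitivity (\det (block_mx (1%:M : 'M_1) v (- (c *: u)) B)).
  have -> : block_mx (1%:M : 'M_1) v (- (c *: u)) B =
     block_mx 1%:M 0 (- (c *: u)) 1%:M *m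
     block_mx 1%:M v 0 (B + c *: (u *m v)).
    rewrite mulmx_block !mul1mx !mulmx1 !mul0mx !addr0.
    by rewrite mulNmx -scalemxAl addrC addrK.
  by rewrite det_mulmx det_lblock det_ublock !det1 !mul1r.
rewrite -[LHS]det_tr -[X in _ + c * X]det_tr.
have -> : \det B = \det (block_mx (1%:M : 'M_1) v 0 B)^T.
  by rewrite det_tr det_ublock det1 mul1r.
rewrite !tr_block_mx.
rewrite -[X in X + _]mul1r.
apply: (determinant_multilinear (i0 := lshift n ord0)).
- by rewrite !rowKu; apply/rowP => j; rewrite !mxE; case: splitP => k _;
    rewrite !mxE ?ord1 ?eqxx /= ?mulr1 ?mulr0 ?addr0 ?add0r ?mulrN.
- apply/matrixP => i j; rewrite !mxE; case: splitP => k //=.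
  by rewrite ord1.
- apply/matrixP => i j; rewrite !mxE; case: splitP => k //=.
  by rewrite ord1.
Qed.

(** Weight of a step from color i to color j. Only the endpoint contributes its variable, so around
    a closed walk each vertex is counted once. *)
Definition ascent_mx (t : R) (x : 'I_n -> R) : 'M_n :=
  \matrix_(i, j) (x j * (if (i < j)%N then t else (j < i)%N%:R)).

Lemma det1sub_ascent (t : R) (x : 'I_n -> R) :
  (1 - t) * \det (1%:M - ascent_mx t x) =
  \prod_j (1 + t * x j) - t * \prod_j (1 + x j).
Proof.
have [g gE] := det_rank1_affine (1%:M - ascent_mx t x)
  (const_mx 1) (\row_j x j).
have dE c i j : (1%:M - ascent_mx t x + c *: (const_mx 1 *m \row_j x j)) i j =
   (i == j)%:R + x j * (c - (if (i < j)%N then t else (j < i)%N%:R)).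
  by rewrite !mxE big_ord1 !mxE mul1r; ring.
(* c = t clears the entries above the diagonal and c = 1 those below; the two values of the
   determinant then allow g to be eliminated. *)
have := gE t; rewrite det_trig; last first.
  apply/is_trig_mxP => i j ij; rewrite dE ij subrr mulr0 addr0.
  by rewrite (_ : (i == j) = false) //; apply/negbTE/eqP => e;
    rewrite e ltnn in ij.
have := gE 1; rewrite -det_tr det_trig; last first.
  apply/is_trig_mxP => i j ij; rewrite mxE dE ij.
  rewrite ltnNge (ltnW ij) subrr mulr0 addr0.
  by rewrite (_ : (j == i) = false) //; apply/negbTE/eqP => e;
    rewrite e ltnn in ij.
rewrite (eq_bigr (fun i => 1 + x i)) => [->|i _]; last first.
  by rewrite mxE dE eqxx ltnn subr0 mulr1.
rewrite (eq_bigr (fun i => 1 + t * x i)) => [->|i _]; last first.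
  by rewrite dE eqxx ltnn subr0 mulrC.
by ring.
Qed.
End AscentMatrix.

Definition fin_elemsym (R : comNzRingType) n (x : 'I_n -> R) k : R :=
  \sum_(S : {set 'I_n} | #|S| == k) \prod_(j in S) x j.

Lemma coef_prod1DX (R : comNzRingType) n (x : 'I_n -> R) k :
  (\prod_j (1 + (x j)%:P * 'X))`_k = fin_elemsym x k.
Proof.
rewrite (eq_bigr (fun j => (x j)%:P * 'X + 1)) => [|j _]; last exact: addrC.
rewrite bigA_distr coef_sum /fin_elemsym [RHS]big_mkcond.
apply: eq_bigr => S _ /=.
rewrite -big_mkcond big_split -rmorph_prod /= prodr_const coefCM coefXn eq_sym.
by case: eqP; rewrite ?mulr1 ?mulr0.
Qed.

Lemma fin_elemsymZ (R : comNzRingType) n (t : R) (x : 'I_n -> R) k :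
  fin_elemsym (fun j => t * x j) k = t ^+ k * fin_elemsym x k.
Proof.
rewrite /fin_elemsym mulr_sumr; apply: eq_bigr => S /eqP <-.
by rewrite big_split prodr_const.
Qed.

(** The determinant identity is applied over R[X] to the elements x_j X, and coefficients of X^k are
    compared. *)
Lemma det1subX_ascent (R : comNzRingType) n (t : R) (x : 'I_n -> R) k :
  (1 - t) * (det1subX (ascent_mx t x))`_k = (t ^+ k - t) * fin_elemsym x k.
Proof.
have := det1sub_ascent t%:P (fun j => (x j)%:P * 'X).
have -> : 1%:M - ascent_mx t%:P (fun j => (x j)%:P * 'X) =
          1%:M - 'X *: map_mx polyC (ascent_mx t x).
  apply/matrixP => i j; rewrite !mxE; congr (_ - _).
  rewrite polyCM mulrCA mulrA; congr (_ * _).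
  by case: ifP => // _; rewrite polyCMn.
rewrite -/(det1subX _) -polyC1 -polyCB => /(congr1 (fun p : {poly R} => p`_k)).
rewrite coefCM coefB coefCM => ->; rewrite mulrBl.
under eq_bigr => j _ do rewrite mulrA -polyCM.
by rewrite polyC1 !coef_prod1DX fin_elemsymZ.
Qed.

(** As t^(i+1) - t = - (1 - t) t [i]_t, cancelling 1 - t gives p_0 = 1 and p_(i+1) = - t [i]_t
    e_(i+1) for the coefficients p_i of the determinant. Newton's identity, solved for its i = 0
    term, is then the recurrence. *)
Lemma mxtrace_ascent_rec (R : comNzRingType) n (t : R) (x : 'I_n.+1 -> R) k :
  GRing.lreg (1 - t) ->
  let M := ascent_mx t x in
  \tr (M ^+ k.+1) = (t * \sum_(j < k) t ^+ j) * fin_elemsym x k.+1 *+ k.+1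
    + \sum_(i < k) (t * \sum_(j < i) t ^+ j) * fin_elemsym x i.+1
        * \tr (M ^+ (k - i)).
Proof.
move=> t1 M.
have p0 : (det1subX M)`_0 = 1.
  apply: t1; rewrite det1subX_ascent expr0; congr (_ * _).
  rewrite /fin_elemsym (big_pred1 finset.set0) => [|S]; last first.
    by rewrite cards_eq0.
  by rewrite finset.big_set0.
have pS i : (det1subX M)`_i.+1 =
    - ((t * \sum_(j < i) t ^+ j) * fin_elemsym x i.+1).
  apply: t1; rewrite det1subX_ascent.
  have -> : t ^+ i.+1 - t = t * ((t - 1) * \sum_(j < i) t ^+ j).
    by rewrite -subrX1 mulrBr mulr1 exprS.
  by ring.
have := newton_det1subX M k; rewrite big_ord_recl p0 mul1r subn0.
rewrite pS mulNrn => /oppr_inj ->; rewrite -[LHS]addr0 -addrA.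
congr (_ + _); apply/esym; rewrite -big_split big1 // => i _ /=.
by rewrite pS subnSK // mulNr addNr.
Qed.

(** * Matrix powers and traces as sums over walks *)

Section ClosedWalks.
Variables (R : comNzRingType) (n : nat) (M : 'M[R]_n.+1).

(** The tuple lists all vertices of the walk but the last; the final vertex b is supplied as the
    default value of [nth], reached at index k+1. *)
Lemma expmx_walks k a b : (M ^+ k.+1) a b =
  \sum_(u : k.+1.-tuple 'I_n.+1 | thead u == a)
     \prod_(i < k.+1) M (nth b u i) (nth b u i.+1).
Proof.
elim: k a => [|k IHk] a.
  rewrite (big_pred1 [tuple a]) => [|u]; first by rewrite big_ord1 expr1.
  by case/tupleP: u => c u; rewrite theadE (tuple0 u); apply/eqP/eqP=> [->|[]].
rewrite exprS mxE.
under eq_bigr => c _ do rewrite IHk mulr_sumr.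
rewrite (exchange_big_dep xpredT) //=.
rewrite (reindex_onto (fun u : k.+1.-tuple 'I_n.+1 => [tuple of a :: u])
          (fun u => [tuple of behead u])) => [|u /eqP <-]; last first.
  by case/tupleP: u => c u; apply: val_inj.
apply: eq_big => [u|u _].
  by rewrite theadE eqxx; apply/esym/eqP/val_inj.
rewrite (big_pred1 (thead u)) => [|c]; last by rewrite eq_sym.
rewrite [RHS]big_ord_recl /=; congr (M _ _ * _).
by case/tupleP: u => c u.
Qed.

Lemma mxtrace_closed_walks k : \tr (M ^+ k.+1) =
  \sum_(u : k.+1.-tuple 'I_n.+1) \prod_i M (tnth u i) (tnth u (ordS i)).
Proof.
rewrite /mxtrace; under eq_bigr => a _ do rewrite expmx_walks.
rewrite (exchange_big_dep xpredT) //=; apply: eq_bigr => u _.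
rewrite (big_pred1 (thead u)) => [|c]; last by rewrite eq_sym.
apply: eq_bigr => i _; rewrite !(tnth_nth (thead u)); congr (M _ _).
(* At the last index [ordS] wraps around to 0, while [nth] runs off the end and returns its default,
   the head of u. *)
rewrite /=; have := ltn_ord i; rewrite leq_eqVlt => /predU1P[->|ik].
  by rewrite modnn nth_default ?size_tuple //; case/tupleP: u.
by rewrite modn_small.
Qed.
End ClosedWalks.

(** * Reduction of a single coefficient to finitely many colors *)

Section FiniteColors.

(** Only the support matters, and [h] enumerates at least the support without repetition. This turns
    the finitely supported sums defining coefficients into finite ones. *)
Lemma fsbig_fintype (R : nmodType) (T : choiceType) (J : finType) (P : set T)
    (Q : pred J) (h : J -> T) (F : T -> R) :
  injective h -> (forall j, Q j -> P (h j)) ->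
  (forall i, P i -> F i != 0 -> exists2 j, Q j & h j = i) ->
  \sum_(i \in P) F i = \sum_(j | Q j) F (h j).
Proof.
move=> h_inj hQ hP; rewrite fsbig_supp.
rewrite (fsbig_fwiden [seq h j | j <- enum Q]).
- by rewrite big_map big_enum_cond /=; apply: eq_bigl => j; rewrite andbT.
- move=> i /= [Pi /eqP Fi]; have [j Qj <-] := hP i Pi Fi.
  by apply/mapP; exists j; rewrite ?mem_enum.
- by rewrite map_inj_uniq ?enum_uniq.
move=> i /= [/mapP[j]]; rewrite mem_enum => /hQ Pj -> nPF.
by apply: contrapT => Fj; apply: nPF.
Qed.

Definition color_of n (j : 'I_n) : color := exist _ j.+1 (ltn0Sn j).

Lemma color_of_inj n : injective (@color_of n).
Proof. by move=> i j [] /val_inj. Qed.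

Definition colored_below n (m : {cmonom color}) :=
  forall i, i \in finsupp m -> exists j : 'I_n, color_of j = i.

Lemma exists_colored_below m : exists n, colored_below n.+1 m.
Proof.
exists (\max_(i <- finsupp m) val i) => i im.
have lt : ((val i).-1 < (\max_(i <- finsupp m) val i).+1)%N.
  by rewrite ltnS (leq_trans (leq_pred _)) // (big_fsetD1 i) //= leq_maxl.
by exists (Ordinal lt); apply: val_inj; rewrite /= prednK // (valP i).
Qed.

Lemma colored_below_cmdivs n m a :
  colored_below n m -> a \in cmdivs m -> colored_below n a.
Proof.
move=> mn /cmdivsP[b ab] i ia; apply: mn; rewrite -ab mdomD.
by rewrite inE ia.
Qed.

Variables (R : comNzRingType) (n : nat).
Local Notation x := (fun j : 'I_n => fps_var (color_of j) : fps color R).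

(** A set of colors contributes to the coefficient of m only if its product is m, so all its colors
    occur in m and hence are among the first n. *)
Lemma elemsym_coef_fin m k : colored_below n m ->
  elemsym k m = fin_elemsym x k m.
Proof.
move=> mn; rewrite /fin_elemsym fcoef_sum /elemsym /=.
have memh (S : {set 'I_n}) j :
    (color_of j \in [fset color_of i | i in S]%fset) = (j \in S).
  by rewrite mem_imfset //=; exact: color_of_inj.
rewrite (@fsbig_fintype _ _ {set 'I_n} _ (fun S => #|S| == k)
  (fun S => [fset color_of j | j in S]%fset)).
- apply: eq_bigr => S _; congr (fcoef _ m).
  rewrite big_imfset /=; last by move=> i j _ _; exact: color_of_inj.
  by rewrite big_enum.
- by move=> S S' SS'; apply/setP => j; rewrite -!memh SS'.
- move=> S /eqP <-; rewrite /= card_imfset /=; last exact: color_of_inj.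
  by rewrite cardE.
move=> /= S Sk; rewrite fps_prod_var /=.
case: (m =P _) => [mE _|]; last by rewrite eqxx.
have SE :
    S = [fset color_of j | j in [set j : 'I_n | color_of j \in S]%SET]%fset.
  apply/fsetP => i; apply/idP/imfsetP => [iS|[j /=]]; last first.
    by rewrite inE => ? ->.
  have [|j ji] := mn i.
    by rewrite -cmE_neq0 mE (big_fsetD1 i) //= cmM cmU eqxx.
  by exists j; rewrite //= inE ji.
exists [set j : 'I_n | color_of j \in S]%SET; last exact/esym.
rewrite -Sk {2}SE card_imfset /=; last exact: color_of_inj.
by rewrite cardE.
Qed.
End FiniteColors.

(** * Proper colorings of the directed cycle as closed walks *)

Lemma asc_dcycle n (kappa : {ffun 'I_n -> color}) :
  asc (dcycle n) kappa = #|[pred i | val (kappa i) < val (kappa (ordS i))]%N|.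
Proof.
have inj : injective (fun i : 'I_n => (i, ordS i)) by move=> i j [].
rewrite /asc -[RHS](fintype.card_image inj); apply: eq_card => -[i j].
rewrite !inE /= /dcycle.
apply/andP/fintype.imageP => [[/eqP -> ij]|[k kk [-> ->]]].
  by exists i.
by rewrite eqxx.
Qed.

Lemma prod_ascent_mx n N (x : 'I_N -> fps color {poly int})
    (u : n.-tuple 'I_N) :
  \prod_i ascent_mx 'X%:A x (tnth u i) (tnth u (ordS i)) =
  if [forall i, tnth u i != tnth u (ordS i)] then
    'X^(#|[pred i | tnth u i < tnth u (ordS i)]%N|) *: \prod_i x (tnth u i)
  else 0.
Proof.
under eq_bigr => i _ do rewrite mxE.
case: ifPn => [/forallP un|/forallPn[i /negPn /eqP ui]]; last first.
  by rewrite (bigD1 i) //= ui !ltnn mulr0 mul0r.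
rewrite big_split /= mulrC -[RHS]mulr_algl; congr (_ * _); last first.
  (* The variables sit at the endpoints of the steps; rotating the cycle moves them to the starting
     points. *)
  by rewrite [RHS](reindex_inj (@ordS_inj _)).
rewrite (eq_bigr
  (fun i => if (tnth u i < tnth u (ordS i))%N then 'X%:A else 1)).
  rewrite -big_mkcond prodr_const.
  by rewrite -(rmorphXn (GRing.in_alg _)).
move=> i _; case: ltngtP => // /val_inj uE; by move: (un i); rewrite uE eqxx.
Qed.

(** Colorings contributing to m use only colors of m, so they are closed walks in the truncated
    color set. Walks with a constant step have weight 0, which leaves exactly the proper
    colorings. *)
Lemma chromqsym_dcycle_coef_fin n N m : colored_below N.+1 m ->
  chromqsym (dcycle n.+1) m =
  (\tr (ascent_mx 'X%:A (fun j : 'I_N.+1 => fps_var (color_of j)) ^+ n.+1)) m.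
Proof.
move=> mN; rewrite mxtrace_closed_walks fcoef_sum /=.
under [in RHS]eq_bigr => u _ do rewrite prod_ascent_mx.
rewrite (@fsbig_fintype _ _ (n.+1.-tuple 'I_N.+1) _
  (fun u => [forall i, tnth u i != tnth u (ordS i)])
  (fun u => [ffun i => color_of (tnth u i)])).
- rewrite [LHS]big_mkcond; apply: eq_bigr => u _.
  case: ifP => [_|//]; rewrite asc_dcycle fcoefZ.
  under [in LHS]eq_bigr => i _ do rewrite ffunE.
  congr ('X^_ * _); apply: eq_card => i.
  by rewrite !inE !ffunE /= ltnS.
- move=> u v /ffunP uv; apply: eq_from_tnth => i.
  by apply: color_of_inj; have := uv i; rewrite !ffunE.
- move=> u /forallP un i j; rewrite !ffunE (inj_eq (@color_of_inj _)).
  by case/orP => /eqP ->; rewrite // eq_sym.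
move=> kappa /= kP; rewrite fps_prod_var /=.
case: (m =P _) => [mE _|]; last by rewrite mulr0 eqxx.
have kc i : {j : 'I_N.+1 | color_of j = kappa i}.
  apply/cid/mN; rewrite -cmE_neq0 mE (bigD1 i) //= cmM cmU eqxx.
  by [].
pose u := [tuple sval (kc i) | i < n.+1].
have uE : [ffun i => color_of (tnth u i)] = kappa.
  by apply/ffunP => i; rewrite ffunE tnth_mktuple; case: (kc i).
exists u => //; apply/forallP => i.
have := kP i (ordS i); rewrite -uE !ffunE (inj_eq (@color_of_inj _)).
by apply; rewrite /dcycle eqxx.
Qed.

(** * The recurrence for the chromatic quasisymmetric functions of cycles *)

(** Truncated and full series agree only at monomials with few colors. Divisors of such monomials
    are again such, so the agreement passes to products. *)
Lemma fcoefM_cmdivs (I : choiceType) (R : comNzRingType)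
    (f f' g g' : fps I R) m :
  (forall a, a \in cmdivs m -> f a = f' a) ->
  (forall a, a \in cmdivs m -> g a = g' a) ->
  (f * g) m = (f' * g') m.
Proof.
move=> ff' gg'; rewrite !fcoefME; apply: eq_big_seq => a am.
by apply: eq_big_seq => b bm; rewrite ff' ?gg'.
Qed.

(** A constant acts coefficientwise, so it cancels as it does in R; this is what permits cancelling
    1 - t. *)
Lemma fps_algebra_lreg (I : choiceType) (R : idomainType) (c : R) :
  c != 0 -> GRing.lreg (c%:A : fps I R).
Proof.
move=> c0 f g; rewrite !mulr_algl => /(congr1 (@fcoef I R)) fg.
by apply: fpsP => m; apply: (mulfI c0); rewrite -!fcoefZ fg.
Qed.

(** At each monomial m, enough colors are kept to contain those of m, and the identity becomes the
    trace recurrence. The summand i = 0, with e_1, vanishes because [0]_t = 0. *)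
Lemma chromqsym_dcycle_rec k :
  chromqsym (dcycle k.+1) =
    (k.+1%:R * ('X * tnum k)) *: elemsym k.+1
    + \sum_(i < k) ('X * tnum i) *: (elemsym i.+1 * chromqsym (dcycle (k - i))).
Proof.
apply: fpsP => m; have [N mN] := exists_colored_below m.
rewrite (chromqsym_dcycle_coef_fin _ mN) mxtrace_ascent_rec; last first.
  have -> : 1 - 'X%:A = (1 - 'X)%:A :> fps color {poly int}.
    by rewrite scalerBl scale1r.
  by apply: fps_algebra_lreg; rewrite -oppr_eq0 opprB -polyC1 polyXsubC_eq0.
have tE i : ('X%:A * \sum_(j < i) 'X%:A ^+ j : fps color {poly int}) =
            ('X * tnum i)%:A.
  rewrite -[RHS]/(GRing.in_alg _ _) rmorphM rmorph_sum; congr (_ * _).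
  by apply: eq_bigr => j _; rewrite rmorphXn.
rewrite !fcoefD !fcoef_sum; congr (_ + _).
  rewrite tE mulr_algl -scaler_nat scalerA fcoefZ fcoefZ.
  by rewrite (elemsym_coef_fin _ _ mN).
apply: eq_bigr => i _; rewrite tE -mulrA mulr_algl !fcoefZ; congr (_ * _).
rewrite -(subnSK (ltn_ord i)); apply/esym/fcoefM_cmdivs => a am.
  by rewrite (elemsym_coef_fin _ _ (colored_below_cmdivs mN am)).
by rewrite (chromqsym_dcycle_coef_fin _ (colored_below_cmdivs mN am)).
Qed.

(** * Power series in z and the generating function identity *)

Section ZSeries.
Variable R : comNzRingType.
Implicit Types (F G : nat -> R) (m : {cmonom unit}).

(** A monomial in one variable is determined by its degree, so such a series is just a sequence. *)
Definition zseries_of F : fps unit R := Fps (fun m => F (mdeg m)).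

Lemma mdeg_unit_inj : injective (@mdeg unit).
Proof.
have mE m : mdeg m = m tt.
  rewrite (@mdegEw _ _ [fset tt]%fset) ?big_seq_fset1 //.
  by apply/fsubsetP => -[]; rewrite inE.
by move=> a b; rewrite !mE => ab; apply/eqP/cmP => -[].
Qed.

Lemma zseries_of_sum (A : set nat) F :
  \fps_sum_(n \in A) F n *: fps_var tt ^+ n =
  zseries_of (fun n => if n \in A then F n else 0).
Proof.
apply: fpsP => m /=.
have zE n : (fps_var tt ^+ n : fps unit R) m = (mdeg m == n)%:R.
  rewrite -[n in _ ^+ n]card_ord -prodr_const fps_prod_var /=.
  rewrite -(inj_eq mdeg_unit_inj) mdeg_prod.
  under eq_bigr do rewrite mdegU.
  by rewrite sum1_card card_ord.
rewrite (@fsbig_fintype _ _ unit _ (fun=> mdeg m \in A) (fun=> mdeg m)).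
- case: ifP => mA; last by rewrite big_pred0.
  by rewrite (big_pred1 tt) => [|[]//]; rewrite zE eqxx mulr1.
- by case=> [] [].
- by move=> _ /set_mem.
move=> n An; rewrite zE; case: (mdeg m =P n) => [->|_]; last first.
  by rewrite mulr0 eqxx.
by exists tt => //; apply/mem_set.
Qed.

Lemma zseries_of_mul F G : zseries_of F * zseries_of G =
  zseries_of (fun n => \sum_(i < n.+1) F i * G (n - i)%N).
Proof.
apply: fpsP => m; rewrite fcoefM /=.
pose z i : {cmonom unit} := \big[mmul/mone]_(j < i) ucm tt.
have dz i : mdeg (z i) = i.
  rewrite mdeg_prod; under eq_bigr do rewrite mdegU.
  by rewrite sum1_card card_ord.
rewrite (@fsbig_fintype _ _ 'I_(mdeg m).+1 _ predT
  (fun i => (z i, z (mdeg m - i)%N))).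
- by apply: eq_bigr => i _; rewrite !dz.
- by move=> i j [/(congr1 mdeg)]; rewrite !dz => /val_inj.
- by move=> i _; apply: mdeg_unit_inj; rewrite /= mdegM !dz subnKC // -ltnS.
move=> [a b] /= abm _; have lt : (mdeg a < (mdeg m).+1)%N.
  by rewrite -abm mdegM ltnS leq_addr.
exists (Ordinal lt) => //; congr pair; apply: mdeg_unit_inj; rewrite dz //=.
by rewrite -abm mdegM addKn.
Qed.
End ZSeries.


(** The denominator has constant term 1 and is thus a unit; after multiplying it out, the
    coefficient of z^(k+1) is the recurrence. *)
Lemma zseries_dcycle :
  \fps_sum_(n \in [set n : nat | (2 <= n)%N])
      chromqsym (dcycle n) *: zvar ^+ n
   = (tvar * \fps_sum_(k \in [set k : nat | (2 <= k)%N])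
                ((k%:R * tnum k.-1) *: elemsym k) *: zvar ^+ k)
     / (1 - tvar * \fps_sum_(k \in [set k : nat | (2 <= k)%N])
                     (tnum k.-1 *: elemsym k) *: zvar ^+ k).
Proof.
rewrite /zvar 3!zseries_of_sum.
have in2 n : (n \in [set n : nat | (2 <= n)%N]) = (2 <= n)%N.
  by apply/idP/idP => [/set_mem|/mem_set].
have tE F : tvar * zseries_of F = zseries_of (fun n => 'X *: F n).
  by rewrite /tvar mulr_algl; apply: fpsP => m; rewrite fcoefZ mulr_algl.
have tnum0 : tnum 0 = 0 by rewrite /tnum big_ord0.
have chrom1 : chromqsym (dcycle 1) = 0.
  by rewrite chromqsym_dcycle_rec big_ord0 tnum0 !mulr0 scale0r addr0.
set X := fun n => if _ then chromqsym _ else _.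
set V := fun n => if _ then _ *: _ else _; set U := fun n => if _ then _ else _.
(* The terms of index 1 vanish, since X_1 = 0 and [0]_t = 0, so the restriction to indices at least
   2 disappears at all positive indices. *)
have XS n : X n.+1 = chromqsym (dcycle n.+1) by rewrite /X in2; case: n.
have US n : U n.+1 = tnum n *: elemsym n.+1.
  by rewrite /U in2; case: n => //=; rewrite tnum0 scale0r.
have VS n : V n.+1 = (n.+1%:R * tnum n) *: elemsym n.+1.
  by rewrite /V in2; case: n => //=; rewrite tnum0 mulr0 scale0r.
have [X0 U0 V0] : [/\ X 0%N = 0, U 0%N = 0 & V 0%N = 0].
  by rewrite /X /U /V !in2.
move: X U V XS US VS X0 U0 V0 => X U V XS US VS X0 U0 V0.
have dE : 1 - tvar * zseries_of U =
    zseries_of (fun n => (n == 0)%:R - 'X *: U n).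
  by rewrite tE; apply: fpsP => m; rewrite fcoefB fcoef1 /= -mdeg_eq0.
have unitd : 1 - tvar * zseries_of U \is a GRing.unit.
  by apply: fps_unit1; rewrite dE /= mdeg1 U0 scaler0 subr0.
apply: (mulIr unitd); rewrite divrK // dE mulrC zseries_of_mul tE.
congr zseries_of; apply/funext => -[|k];
  rewrite big_ord_recl U0 scaler0 subr0 mul1r subn0.
  by rewrite big_ord0 X0 V0 scaler0 addr0.
rewrite XS VS chromqsym_dcycle_rec scalerA mulrCA -addrA -[RHS]addr0.
congr (_ + _).
(* The last term of the convolution carries X_0 = 0; the others cancel one by one against the
   recurrence. *)
rewrite big_ord_recr /= subnn X0 mulr0 addr0 -big_split big1 // => i _ /=.
rewrite sub0r US subSS -(subnSK (ltn_ord i)) XS scalerA mulNr -scalerAl.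
exact: addrN.
Qed.

(** * Symmetric unimodal polynomials with a prescribed centre *)

Section CenteredUnimodal.
Variable R : numDomainType.
Implicit Types p : {poly R}.

(** The number n is twice the centre of symmetry rather than the degree: coefficients may vanish at
    both ends. Growth is required up to the centre, and symmetry gives the descent. *)
Definition centered_unimodal n p :=
  [/\ forall j, 0 <= p`_j, forall j, (n < j)%N -> p`_j = 0,
      forall j, (j <= n)%N -> p`_j = p`_(n - j)
    & forall j, (j.*2.+1 < n)%N -> p`_j <= p`_j.+1].

Lemma centered_unimodal_homo n p i j : centered_unimodal n p ->
  (i <= j)%N -> (j.*2 <= n)%N -> p`_i <= p`_j.
Proof.
case=> _ _ _ pS; elim: j => [|j IHj]; first by rewrite leqn0 => /eqP ->.
rewrite leq_eqVlt ltnS => /predU1P[-> //|ij] jn.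
by apply: le_trans (IHj ij _) (pS _ _); lia.
Qed.

Lemma centered_unimodal1 : centered_unimodal 0 1.
Proof.
by split=> [j|[|j]|[|j]|[|j]] //; rewrite coef1 ?ler0n.
Qed.

(** The coefficient of t^j in the product is the window sum p_(j-1) + ... + p_(j-k), with [c j i]
    equal to p_(j-i-1), or 0 when that index is negative. *)
Lemma centered_unimodal_mul n k p : centered_unimodal n p ->
  centered_unimodal (n + k.+1) (('X * \sum_(i < k) 'X^i) * p).
Proof.
move=> pn; have [p0 pz ps pu] := pn.
pose c j i := if (j < i.+1)%N then 0 else p`_(j - i.+1).
have cE j : (('X * \sum_(i < k) 'X^i) * p)`_j = \sum_(i < k) c j i.
  rewrite mulr_sumr mulr_suml coef_sum; apply: eq_bigr => i _.
  by rewrite -exprS coefXnM.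
have c0 j i : 0 <= c j i by rewrite /c; case: ifP.
split=> j; rewrite !cE.
- by apply: sumr_ge0.
- move=> jn; apply: big1 => i _; rewrite /c; case: ifP => // _; apply: pz.
  by have := ltn_ord i; lia.
- move=> jn; rewrite [RHS](reindex_inj rev_ord_inj); apply: eq_bigr => i _ /=.
  rewrite /c; have := ltn_ord i => ik; case: ifPn => ji; case: ifPn => ji' //.
  + by rewrite pz //; lia.
  + by rewrite pz //; lia.
  by rewrite ps; [congr (p`_ _) | ]; lia.
case: k {cE} => [|k] jn; first by rewrite !big_ord0.
(* From j to j+1 the window gains p_j and loses p_(j-k-1), the window length being k+1 here. *)
rewrite [leLHS]big_ord_recr [leRHS]big_ord_recl addrC lerD //=.
rewrite /c subn1 /=; case: ifPn => [//|jk]; have [jn2|jn2] := leqP j.*2 n.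
  by apply: centered_unimodal_homo pn _ jn2; lia.
(* Past the centre of [p], p_j is reflected to p_(n-j); j - k - 1 <= n - j holds because j lies left
   of the new centre. *)
rewrite (ps j); last by lia.
by apply: centered_unimodal_homo pn _ _; lia.
Qed.
End CenteredUnimodal.

(** * Expansions in the e_la with centred unimodal coefficients *)

Lemma fcoefM_polyC (f g : fps color {poly int}) (f' g' : fps color int) :
  (forall m, f m = (f' m)%:P) -> (forall m, g m = (g' m)%:P) ->
  forall m, (f * g) m = ((f' * g') m)%:P.
Proof.
move=> ff' gg' m; rewrite !fcoefME rmorph_sum; apply: eq_bigr => a _.
rewrite rmorph_sum; apply: eq_bigr => b _.
by rewrite rmorphMn rmorphM ff' gg'.
Qed.

Lemma elemsym_polyC k m :
  (elemsym k : fps color {poly int}) m = (elemsym k m)%:P.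
Proof.
have [N mN] := exists_colored_below m.
rewrite !(elemsym_coef_fin _ _ mN) !fcoef_sum rmorph_sum.
by apply: eq_bigr => S _; rewrite !fps_prod_var /= rmorph_nat.
Qed.

(** Since e_la is free of t, the coefficient of t^j in p(t) e_la is p_j e_la. *)
Lemma elemsym_part_polyC la m :
  (elemsym_part la : fps color {poly int}) m = (elemsym_part la m)%:P.
Proof.
rewrite /elemsym_part; elim: la m => [|k la IHla] m.
  by rewrite !big_nil !fcoef1 rmorph_nat.
by rewrite !big_cons (fcoefM_polyC (elemsym_polyC k) IHla).
Qed.

(** Terms with equal partitions are collected, because [e_positive] asks for distinct ones; sums of
    nonnegative coefficients stay nonnegative. *)
Lemma e_positive_sum (I : eqType) (r : seq I) (a : I -> int)
    (la : I -> seq nat) :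
  (forall i, i \in r -> 0 <= a i) ->
  (forall i, i \in r -> is_partition (la i)) ->
  e_positive (\sum_(i <- r) a i *: elemsym_part (la i)).
Proof.
move=> a0 laP; exists (undup (map la r)).
exists (fun mu => \sum_(i <- r | la i == mu) a i); split.
- exact: undup_uniq.
- by move=> mu; rewrite mem_undup => /mapP[i ir ->]; exact: laP.
- by move=> mu _; rewrite big_seq_cond; apply: sumr_ge0 => i /andP[/a0].
under [RHS]eq_bigr => mu _ do rewrite scaler_suml big_mkcond.
rewrite exchange_big; apply: eq_big_seq => i ir /=.
rewrite (bigD1_seq (la i)) ?undup_uniq ?mem_undup ?map_f //= eqxx.
by rewrite big1 ?addr0 // => mu; rewrite eq_sym => /negPf ->.
Qed.

(** The induction claim, from which all three properties follow. Partitions may repeat in the list,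
    so that adding expansions is concatenation. *)
Definition e_centered n (F : fps color {poly int}) : Prop :=
  exists2 r : seq ({poly int} * seq nat),
    forall x, x \in r -> centered_unimodal n x.1 /\ is_partition x.2
    & F = \sum_(x <- r) x.1 *: elemsym_part x.2.

Lemma e_centeredD n F G :
  e_centered n F -> e_centered n G -> e_centered n (F + G).
Proof.
move=> [r rn ->] [s sn ->]; exists (r ++ s); last by rewrite big_cat.
by move=> x; rewrite mem_cat => /orP[/rn|/sn].
Qed.

Lemma e_centered_sum n (I : Type) (r : seq I) (F : I -> fps color {poly int}) :
  (forall i, e_centered n (F i)) -> e_centered n (\sum_(i <- r) F i).
Proof.
move=> Fn; elim/big_rec: _ => [|i G _]; last exact: e_centeredD.
by exists [::]; rewrite ?big_nil.
Qed.

Lemma e_centered1 : e_centered 0 1.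
Proof.
exists [:: (1, [::])]; last by rewrite big_seq1 scale1r /elemsym_part big_nil.
by move=> x; rewrite inE => /eqP ->; split=> //; exact: centered_unimodal1.
Qed.

(** This handles one summand of the recurrence: e_(k+1) inserts the part k+1 into each partition,
    and t [k]_t moves each centre by (k+1)/2. *)
Lemma e_centered_mul n k F : e_centered n F ->
  e_centered (n + k.+1) (('X * tnum k) *: (elemsym k.+1 * F)).
Proof.
case=> r rn ->.
exists [seq ('X * tnum k * x.1, sort geq (k.+1 :: x.2)) | x <- r].
  move=> _ /mapP[x /rn [xn /andP[xs xp]] ->]; split=> /=.
    exact: centered_unimodal_mul.
  rewrite /is_partition sort_sorted /=; last by move=> i j; exact: leq_total.
  by rewrite all_sort.
rewrite big_map [elemsym _ * _]mulr_sumr scaler_sumr; apply: eq_bigr => x _ /=.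
rewrite -scalerAr scalerA; congr (_ *: _).
by rewrite /elemsym_part (perm_big _ (permEl (perm_sort _ _))) big_cons.
Qed.

Lemma e_centered_dcycle n : e_centered n.+1 (chromqsym (dcycle n.+1)).
Proof.
elim/ltn_ind: n => n IHn; rewrite chromqsym_dcycle_rec.
(* The integer factor n+1 is spread over n+1 equal summands, each of the shape covered by
   [e_centered_mul]. *)
have -> : (n.+1%:R * ('X * tnum n)) *: elemsym n.+1 =
    \sum_(i < n.+1) ('X * tnum n) *: (elemsym n.+1 * 1) :> fps color {poly int}.
  by rewrite sumr_const card_ord mulr1 -scalerA scaler_nat.
apply: e_centeredD; apply: e_centered_sum => i.
  by rewrite -[n.+1]add0n; apply: e_centered_mul e_centered1.
(* The remaining cycle has n - i vertices, and the factor with e_(i+1) supplies the missing i+1. *)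
have -> : n.+1 = ((n - i.+1).+1 + i.+1)%N by rewrite addSn subnK.
rewrite -(subnSK (ltn_ord i)); apply/e_centered_mul/IHn.
by have := ltn_ord i; lia.
Qed.

Lemma e_centered_properties n F : e_centered n F ->
  [/\ t_palindromic n F, t_e_positive n F & t_e_unimodal n F].
Proof.
case=> r rn FE; have coefE j :
    t_coef F j = \sum_(x <- r) (x.1)`_j *: elemsym_part x.2.
  apply: fpsP => m; rewrite FE /= !fcoef_sum coef_sum; apply: eq_bigr => x _.
  by rewrite fcoefZ elemsym_part_polyC coefMC.
split=> j jn; rewrite ?coefE.
- by apply: eq_big_seq => x /rn [[_ _ ps _] _]; rewrite ps.
- by apply: e_positive_sum => x /rn [[p0 _ _ _] xP].
rewrite -sumrB; under eq_bigr => x _ do rewrite -scalerBl.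
apply: e_positive_sum => x /rn [[_ _ _ pu] xP] //.
by rewrite subr_ge0 pu.
Qed.

Theorem theorem12 :
  (\fps_sum_(n \in [set n : nat | (2 <= n)%N])
      chromqsym (dcycle n) *: zvar ^+ n
   = (tvar * \fps_sum_(k \in [set k : nat | (2 <= k)%N])
                ((k%:R * tnum k.-1) *: elemsym k) *: zvar ^+ k)
     / (1 - tvar * \fps_sum_(k \in [set k : nat | (2 <= k)%N])
                     (tnum k.-1 *: elemsym k) *: zvar ^+ k))
  /\ (forall n : nat, (2 <= n)%N ->
        [/\ t_palindromic (nedges (dcycle n)) (chromqsym (dcycle n)),
            t_e_positive (nedges (dcycle n)) (chromqsym (dcycle n))
          & t_e_unimodal (nedges (dcycle n)) (chromqsym (dcycle n))]).
Proof.
split=> [|[|n] // _]; first exact: zseries_dcycle.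
rewrite nedges_dcycle; exact/e_centered_properties/e_centered_dcycle.
Qed.
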